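(* Let $f(n)=b_{d}n^{d}+\cdots+b_{0}$ be a polynomial with integer coefficients such that $b_{d}>0$, $\gcd(b_{d},\ldots,b_{0})=1$, and $f(p)\in\mathbb{N}$ for every prime $p$. Then there exist positive constants $C$, $c_{1}$, $c_{2}$ depending only on $f$ such that for every real $x\geq 2$, every $s\in\mathbb{N}$ and every $t>0$, \[ \sum_{p\leq x}\Big(\frac{f(p)}{\varphi(f(p))}\Big)^{s}\leq \exp\big(s\log\log(s+2)+Cs\big)\,\pi(x) \] and \[ \#\Big\{p\leq x:\ \frac{f(p)}{\varphi(f(p))}>t\Big\}\leq c_{1}\exp\big(-\exp(c_{2}t)\big)\,\pi(x), \] where $p$ ranges over primes.
   Context: $\varphi$ denotes Euler's totient function; $\pi(x)$ is the number of primes not exceeding $x$; $\log$ is the natural logarithm; $\mathbb{N}$ is the set of positive integers. *)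

(* Defs.v *)
From HB Require Import structures.
From mathcomp Require Import all_boot all_order all_algebra.
From mathcomp Require Import reals.

Set Implicit Arguments.
Unset Strict Implicit.
Unset Printing Implicit Defensive.

Import Order.TTheory GRing.Theory Num.Theory.

Local Open Scope ring_scope.

Definition primes_upto (R : realType) (x : R) : seq nat :=
  [seq p <- iota 0 (Num.truncn x).+1 | prime p].

Lemma primes_upto_uniq (R : realType) (x : R) : uniq (primes_upto x).
Proof. by rewrite filter_uniq ?iota_uniq. Qed.

Lemma mem_primes_upto (R : realType) (x : R) (p : nat) :
  0 <= x -> (p \in primes_upto x) = prime p && (p%:R <= x).
Proof.
move=> x0; rewrite mem_filter mem_iota /= add0n ltnS.
by rewrite truncn_ge_nat.
Qed.

Definition prime_pi (R : realType) (x : R) : nat := size (primes_upto x).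

(* `|f.[n]|%N is only a cast from int to nat: f is assumed to be positive at
   the points n where this is used. *)
Definition val_over_totient (R : realType) (f : {poly int}) (n : nat) : R :=
  let m := `|f.[n%:Z]|%N in m%:R / (totient m)%:R.

(* Main.v *)
(* Write F p = f(p) and n = floor(x), and let k denote a squarefree number with w(k) prime factors,
   and D = deg f + 1.
   The whole theorem rests on the estimate
     #{p <= n : k | F p} <= M D^w(k) k^(-d) pi(n),   with a small d > 0, uniformly in k.
   For k^2 <= n it needs no sieve, only Chebyshev's argument inside each residue class a mod k:
   with m = floor(n/k), the part of m! prime to k divides prod_(j <= m) (k j + a), so the product of
   the primes in (m, n] congruent to a is at most (2 k^2)^m. This loses a factor log k against
   Brun-Titchmarsh, which is harmless. For k^2 > n the trivial bound n/k + 1 per class is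
   O(sqrt n), and k | F p forces k = O(n^D), so that n^(-1/4) = O(k^(-d)).
   Now F p / phi(F p) is at most the Mertens product over q <= s + 2, which is O(log (s + 2)), times
   the product of q/(q-1) over the primes q > s + 2 dividing F p. The s-th power of the latter is at
   most prod (1 + 8 s/q); expanding it and averaging over p gives at most
   M prod_q (1 + 8 s D q^(-1-d)) = exp (O(s)). The tail bound is Markov's inequality for the moment
   of order s close to exp(c t). *)
Require Import Defs.
From HB Require Import structures.
From mathcomp Require Import all_boot all_order all_algebra.
From mathcomp Require Import reals sequences exp.
From mathcomp Require Import zify ring lra.

Set Implicit Arguments.
Unset Strict Implicit.
Unset Printing Implicit Defensive.

Import Order.TTheory GRing.Theory Num.Theory.

Local Open Scope nat_scope.

(** * Chebyshev's argument *)

Lemma prod_dvdn_coprime (I : eqType) (s : seq I) (F : I -> nat) m :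
  uniq s -> {in s &, forall i j, i != j -> coprime (F i) (F j)} ->
  {in s, forall i, F i %| m} -> \prod_(i <- s) F i %| m.
Proof.
elim: s => [|i s IHs] /=; first by rewrite big_nil dvd1n.
case/andP=> s'i us co dv; rewrite big_cons Gauss_dvd.
  rewrite dv ?mem_head //= IHs // => [j k sj sk|j sj].
    by apply: co; rewrite in_cons ?sj ?sk orbT.
  by apply: dv; rewrite in_cons sj orbT.
rewrite big_seq; elim/big_rec: _ => [|j x sj cx]; rewrite ?coprimen1 //.
rewrite coprimeMr cx andbT; apply: co.
- exact: mem_head.
- by rewrite in_cons sj orbT.
- by apply: contraNneq s'i => ->.
Qed.

Lemma prod_primes_dvdn (s : seq nat) m :
  uniq s -> all prime s -> (\prod_(p <- s) p %| m) = all (fun p => p %| m) s.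
Proof.
move=> us /allP ps; apply/idP/allP => [dv p sp | dv].
  by apply: dvdn_trans dv; rewrite (big_rem p) //= dvdn_mulr.
apply: prod_dvdn_coprime => // p q sp sq.
by rewrite prime_coprime ?ps // dvdn_prime2 ?ps.
Qed.

(** Pascal's rule and symmetry make the next central coefficient twice C(2n + 1, n + 1), which is at
    least twice C(2n, n). *)
Lemma leq_bin2n n : 2 ^ n <= 'C(n.*2, n).
Proof.
elim: n => // n IHn; rewrite doubleS binS -[in X in _ + X]bin_sub; last lia.
have -> : n.*2.+1 - n = n.+1 by lia.
rewrite addnn expnS -mul2n leq_mul2l /= (leq_trans IHn) //.
by rewrite binS leq_addl.
Qed.

Lemma bin2n_leq n : 'C(n.*2, n) <= 4 ^ n.
Proof.
have -> : 4 ^ n = (1 + 1) ^ n.*2 by rewrite -mul2n expnM.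
rewrite expnDn.
have nn : n < n.*2.+1 by lia.
by rewrite (bigD1 (Ordinal nn)) //= !exp1n !muln1 leq_addr.
Qed.

Lemma dvdn_fact_leq p n : prime p -> p %| n`! -> p <= n.
Proof.
move=> pp; elim: n => [|n IHn]; first by rewrite dvdn1; case: eqP pp => // ->.
rewrite factS Euclid_dvdM // => /orP[/dvdn_leq -> // | /IHn]; exact: leqW.
Qed.

(** With [m] the half of [n] rounded up, the primes in (m, 2m] divide C(2m, m) <= 4^m, and induction
    handles those up to [m]. *)
Lemma primorial_leq n : \prod_(0 <= p < n.+1 | prime p) p <= 2 ^ (4 * n).
Proof.
elim/ltn_ind: n => n IHn.
(* The exponents will add up to 4m + 2m <= 3n + 3, which is at most 4n from n = 3 on. *)
have [n3|] := ltnP n 3.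
  by case: n n3 {IHn} => [|[|[|]]] //= _; rewrite unlock.
move=> n3; pose m := uphalf n.
have nm : n <= m.*2 by rewrite /m; lia.
have mn : m < n by rewrite /m; lia.
have mid : \prod_(m.+1 <= p < m.*2.+1 | prime p) p <= 4 ^ m.
  apply: leq_trans (bin2n_leq m); apply: dvdn_leq.
    by rewrite bin_gt0; lia.
  rewrite -big_filter prod_primes_dvdn ?filter_uniq ?iota_uniq ?filter_all //.
  apply/allP => p; rewrite mem_filter mem_index_iota => /andP[pp /andP[mp pm]].
  have: p %| (m.*2)`! by rewrite dvdn_fact // prime_gt0.
  rewrite -(@bin_fact m.*2 m); last lia.
  have -> : m.*2 - m = m by lia.
  rewrite !Euclid_dvdM //.
  have np : ~~ (p %| m`!).
    by apply: contraL mp => /(dvdn_fact_leq pp); rewrite -leqNgt.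
  by rewrite (negbTE np) !orbF.
apply: leq_trans (_ : \prod_(0 <= p < m.*2.+1 | prime p) p <= _).
  rewrite (@big_cat_nat _ _ _ n.+1 0 m.*2.+1) //= leq_pmulr //.
  by rewrite prodn_cond_gt0 // => p /prime_gt0.
rewrite (@big_cat_nat _ _ _ m.+1 0 m.*2.+1) //=; last lia.
apply: leq_trans (leq_mul (IHn m mn) mid) _.
rewrite -[4 ^ m]/((2 ^ 2) ^ m) -expnM -expnD leq_exp2l //; rewrite /m; lia.
Qed.

Lemma sum_divn_expn_leq p n K : 1 < p -> \sum_(1 <= k < K.+1) n %/ p ^ k <= n.
Proof.
move=> p1.
(* Repeating the last quotient makes the induction close: twice [a %/ p] is at most [a], for [a]
   equal to [n %/ p ^ K]. *)
suff: \sum_(1 <= k < K.+1) n %/ p ^ k + n %/ p ^ K <= n.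
  by apply: leq_trans; rewrite leq_addr.
elim: K => [|K IHK]; first by rewrite big_nil add0n leq_div.
rewrite big_nat_recr //= -addnA (leq_trans _ IHK) // leq_add2l.
rewrite expnSr divnMA; move: (n %/ p ^ K) => a.
have: a %/ p <= a %/ 2 by exact: leq_div2l.
lia.
Qed.

Lemma logn_fact_leq p n : prime p -> logn p n`! <= n.
Proof. by move=> pp; rewrite logn_fact // sum_divn_expn_leq // prime_gt1. Qed.

Lemma leq_logn_fact p n : prime p -> n %/ p <= logn p n`!.
Proof.
move=> pp; rewrite logn_fact //; case: n => [|n]; first by rewrite div0n.
by rewrite big_nat_recl // expn1 leq_addr.
Qed.

(** In Legendre's formula each power of [p] up to [n] contributes at most 1 to the valuation, as
    integer parts satisfy [x + y] <= [x] + [y] + 1; higher powers contribute nothing. *)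
Lemma expn_logn_bin_leq p n m : prime p -> 0 < n -> m <= n ->
  p ^ logn p 'C(n, m) <= n.
Proof.
move=> pp n0 mn; have p1 := prime_gt1 pp.
suff: logn p 'C(n, m) <= trunc_log p n.
  move=> le; apply: leq_trans (trunc_logP p1 n0).
  by rewrite leq_exp2l.
have : logn p n`! = logn p 'C(n, m) + (logn p m`! + logn p (n - m)`!).
  by rewrite -(bin_fact mn) !lognM ?muln_gt0 ?fact_gt0 ?bin_gt0.
have widen q : q <= n -> logn p q`! = \sum_(1 <= k < n.+1) q %/ p ^ k.
  move=> qn; rewrite logn_fact // [RHS](@big_cat_nat _ _ _ q.+1) //=.
  rewrite [X in _ = _ + X]big_nat_cond [X in _ = _ + X]big1 ?addn0 //.
  move=> k; rewrite andbT => /andP[qk kn]; apply: divn_small.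
  by rewrite (leq_trans qk) // ltnW // ltn_expl.
rewrite !widen ?leq_subr // => eq.
have: \sum_(1 <= k < n.+1) n %/ p ^ k <=
   \sum_(1 <= k < n.+1) (k <= trunc_log p n) +
   (\sum_(1 <= k < n.+1) m %/ p ^ k + \sum_(1 <= k < n.+1) (n - m) %/ p ^ k).
  rewrite -!big_split /= leq_sum // => k _.
  case: (leqP k (trunc_log p n)) => [_|lk].
    have pk : 0 < p ^ k by rewrite expn_gt0 prime_gt0.
    have := divnD m (n - m) pk; rewrite subnKC // => ->.
    by rewrite [leqRHS]addnC leq_add2l leq_b1.
  rewrite divn_small //; apply: leq_trans (trunc_log_ltn n p1) _.
  by rewrite leq_exp2l.
rewrite eq leq_add2r => /leq_trans; apply.
rewrite -(@big_mkcond _ _ _ _ _ (fun k => k <= trunc_log p n) (fun=> 1)) /=.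
rewrite sum1_count; set L := trunc_log p n.
(* Enlarging the range to [maxn n L] avoids comparing [L] with [n]. *)
apply: leq_trans (_ : count (fun k => k <= L) (iota 1 (maxn n L)) <= _).
  rewrite /index_iota subSS subn0.
  by rewrite -(subnKC (leq_maxl n L)) iotaD count_cat leq_addr.
rewrite -(subnKC (leq_maxr n L)) iotaD count_cat.
have -> : count (fun k => k <= L) (iota (1 + L) (maxn n L - L)) = 0.
  by apply/eqP; rewrite -leqn0 leqNgt -has_count -all_predC; apply/allP => k;
    rewrite mem_iota /=; lia.
by rewrite addn0 -[X in _ <= X](size_iota 1) count_size.
Qed.

(** Every prime power in the binomial coefficient is at most [n]. For the central coefficient this
    bounds the number of primes from below. *)
Lemma bin_leq_expn_primes n m : 0 < n -> m <= n ->
  'C(n, m) <= n ^ size [seq p <- index_iota 0 n.+1 | prime p].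
Proof.
move=> n0 mn; have C0 : 0 < 'C(n, m) by rewrite bin_gt0.
pose s := [seq p <- index_iota 0 n.+1 | prime p].
have ps p : p \in s -> prime p by rewrite mem_filter => /andP[].
apply: leq_trans (_ : \prod_(p <- s) p ^ logn p 'C(n, m) <= _).
  apply: dvdn_leq.
    by rewrite big_seq prodn_cond_gt0 // => p /ps pp; rewrite expn_gt0 prime_gt0.
  apply/dvdn_partP => // p; rewrite mem_primes => /and3P[pp _ pC].
  rewrite p_part (big_rem p) /= ?dvdn_mulr //.
  rewrite mem_filter pp mem_index_iota /= ltnS.
  rewrite leqNgt; apply/negP => np.
  have : 0 < logn p 'C(n, m) by rewrite logn_gt0 mem_primes pp C0.
  have := expn_logn_bin_leq pp n0 mn; case: (logn _ _) => // e.
  rewrite expnS => pn _.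
  have := leq_pmulr p (_ : 0 < p ^ e); rewrite expn_gt0 prime_gt0 // => /(_ isT).
  by move=> /leq_trans /(_ pn); rewrite leqNgt np.
rewrite -/s big_seq; apply: leq_trans (_ : \prod_(p <- s | p \in s) n <= _).
  by apply: leq_prod => p /ps pp; exact: expn_logn_bin_leq.
by rewrite -big_seq big_const_seq count_predT iter_muln_1.
Qed.

(** The product is a falling factorial of [c + n], hence a binomial coefficient times n!. *)
Lemma fact_dvdn_prod_succ c n : n`! %| \prod_(1 <= j < n.+1) (j + c).
Proof.
have -> : \prod_(1 <= j < n.+1) (j + c) = (c + n) ^_ n.
  elim: n => [|n IHn]; first by rewrite big_nil ffactn0.
  by rewrite big_nat_recr //= IHn addnS ffactSS mulnC addSn addnC.
by rewrite -bin_ffact dvdn_mull.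
Qed.

(* Multiplying by b^n, where b inverts k modulo M, turns the progression into n consecutive
   integers. *)
Lemma dvdn_prod_progression k a n M :
  coprime k M -> M %| n`! -> M %| \prod_(1 <= j < n.+1) (k * j + a).
Proof.
case: (posnP M) => [-> _|M0 co Mn]; first by rewrite dvd0n eqn0Ngt fact_gt0.
have [k0|k0] := posnP k.
  by move: co; rewrite k0 /coprime gcd0n => /eqP ->; rewrite dvd1n.
have [b bk] : exists b, b * k = 1 %[mod M].
  case: (egcdnP M k0) => b v e _; exists b.
  by rewrite e (eqP co) modnMDl.
have cMb : coprime M b.
  have : coprime M (b * k) by rewrite -coprime_modr bk coprime_modr coprimen1.
  by rewrite coprimeMr => /andP[].
have main : b ^ n * \prod_(1 <= j < n.+1) (k * j + a)
    = \prod_(1 <= j < n.+1) (j + b * a) %[mod M].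
  have -> : b ^ n = \prod_(1 <= j < n.+1) b.
    by rewrite prod_nat_const_nat subn1.
  rewrite -big_split /=.
  elim/big_ind2: _ => // [x1 x2 y1 y2 e1 e2|j _].
    by rewrite -modnMm e1 e2 modnMm.
  by rewrite mulnDr mulnA -modnDml -modnMml bk modnMml mul1n modnDml.
rewrite -(@Gauss_dvdr _ (b ^ n)) ?coprimeXr //.
rewrite /dvdn main -/(dvdn _ _).
exact: dvdn_trans Mn (fact_dvdn_prod_succ _ _).
Qed.

(** A prime dividing [k] has exponent at most [n] in n! and at least [n] in k^n. *)
Lemma fact_partn_leq k n : 0 < k -> n`!`_\pi(k) <= k ^ n.
Proof.
move=> k0; apply: dvdn_leq; first by rewrite expn_gt0 k0.
apply/dvdn_partP => [|p]; first exact: part_gt0.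
rewrite mem_primes => /and3P[pp _ pn].
have pk : p \in \pi(k).
  by rewrite -(pnatE _ pp) (pnat_dvd pn) ?part_pnat.
rewrite p_part pfactor_dvdn ?expn_gt0 ?k0 //.
apply: leq_trans (_ : logn p n`! <= _).
  by apply: dvdn_leq_log; rewrite ?fact_gt0 ?dvdn_part.
rewrite lognX (leq_trans (logn_fact_leq n pp)) // leq_pmulr // logn_gt0.
exact: pk.
Qed.

(** Let A be the product of the [k * j + a] and M the part of n! prime to [k]. Both M and the
    product of the primes divide A, and they are coprime because the primes exceed [n]. Finally A <=
    (2k)^n n! and n!/M <= k^n. *)
Lemma prod_primes_progression k a n (s : seq nat) :
  0 < k -> a < k -> coprime k a -> uniq s ->
  {in s, forall p, [/\ prime p, n < p, p %% k = a & 0 < p %/ k <= n]} ->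
  \prod_(p <- s) p <= (2 * k ^ 2) ^ n.
Proof.
move=> k0 ak co us hs; set M := n`!`_\pi(k)^'.
set A := \prod_(1 <= j < n.+1) (k * j + a).
have M0 : 0 < M by exact: part_gt0.
have sp : all prime s by apply/allP => p /hs[].
have MA : M %| A.
  apply: dvdn_prod_progression; last exact: dvdn_part.
  by rewrite (@pnat_coprime \pi(k)) ?part_pnat // pnat_pi.
have PA : \prod_(p <- s) p %| A.
  rewrite prod_primes_dvdn //; apply/allP => p /hs[pp np pa pk].
  rewrite /A (big_rem (p %/ k)) /=; last by rewrite mem_index_iota ltnS.
  have -> : k * (p %/ k) + a = p by rewrite mulnC -pa -divn_eq.
  exact: dvdn_mulr.
have coP : coprime (\prod_(p <- s) p) M.
  rewrite coprime_sym big_seq; elim/big_rec: _ => [|p x ps cx]; rewrite ?coprimen1 //.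
  rewrite coprimeMr cx andbT coprime_sym prime_coprime; last by case: (hs p ps).
  have [pp np _ _] := hs p ps; apply/negP => /dvdn_trans /(_ (dvdn_part _ _)).
  by move=> /(dvdn_fact_leq pp); rewrite leqNgt np.
have A0 : 0 < A by rewrite /A big_nat prodn_cond_gt0 // => j; nia.
have PM : \prod_(p <- s) p * M <= A by apply: dvdn_leq => //; rewrite Gauss_dvd // PA.
have AL : A <= (2 * k) ^ n * n`!.
  rewrite fact_prod /A.
  have -> : (2 * k) ^ n = \prod_(1 <= j < n.+1) (2 * k).
    by rewrite prod_nat_const_nat subn1.
  rewrite -big_split /= !big_nat; apply: leq_prod => j; nia.
rewrite -(leq_pmul2r M0) (leq_trans PM) // (leq_trans AL) //.
rewrite -(partnC \pi(k) (fact_gt0 n)) mulnA leq_pmul2r //.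
apply: leq_trans (leq_mul (leqnn _) (fact_partn_leq n k0)) _.
by rewrite -expnMn -mulnA.
Qed.

(** * Prime divisors of polynomial values *)

(** Convertible to [primes_upto x] when [n] is the truncation of [x]; [index_iota] suits the big
    operators over intervals. *)
Definition nprimes n := [seq p <- index_iota 0 n.+1 | prime p].

Lemma mem_nprimes n p : (p \in nprimes n) = prime p && (p <= n).
Proof. by rewrite mem_filter mem_index_iota. Qed.

Lemma nprimes_uniq n : uniq (nprimes n).
Proof. by rewrite filter_uniq ?iota_uniq. Qed.

Definition poly_absz (f : {poly int}) n := `|f.[n%:Z]%R|%N.

Lemma horner_modz (f : {poly int}) (x y k : int) :
  (x = y %[mod k])%Z -> (f.[x] = f.[y] %[mod k])%Z.
Proof.
move=> xy; elim/poly_ind: f => [|f c IHf]; first by rewrite !horner0.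
by rewrite !hornerMXaddC -modzDml -modzMm IHf xy modzMm modzDml.
Qed.

Lemma dvdn_poly_absz_mod (f : {poly int}) k n :
  (k %| poly_absz f (n %% k)) = (k %| poly_absz f n).
Proof.
have e : (f.[(n %% k)%:Z]%R = f.[n%:Z]%R %[mod k])%Z.
  by apply: horner_modz; rewrite -modz_nat modz_mod.
rewrite -[LHS]/(k%:Z %| f.[(n %% k)%:Z]%R)%Z -[RHS]/(k%:Z %| f.[n%:Z]%R)%Z.
by apply/dvdz_mod0P/dvdz_mod0P; rewrite e.
Qed.

(** Primitivity keeps the reduction modulo [q] nonzero, so it has fewer roots in the prime field
    than its size, which is at most [size f]. *)
Lemma count_roots_prime (f : {poly int}) q : zcontents f = 1%R -> prime q ->
  count (fun a => q %| poly_absz f a) (iota 0 q) <= size f.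
Proof.
move=> fp pq; pose g : {poly 'F_q} := map_poly intr f.
have cq : q \in [pchar 'F_q]%R by exact: pchar_Fp.
have g0 : g != 0%R.
  apply: contraTneq isT => g0.
  have : (q %| zcontents f)%Z.
    rewrite dvdz_contents; apply/polyOverP => i.
    by rewrite (dvdz_pcharf cq) -(coef_map intr) -/g g0 coef0.
  by rewrite fp dvdzE /= dvdn1 => /eqP q1; rewrite q1 in pq.
rewrite -size_filter.
pose rs := [seq (a%:R)%R : 'F_q | a <- [seq a <- iota 0 q | q %| poly_absz f a]].
have -> : size [seq a <- iota 0 q | q %| poly_absz f a] = size rs by rewrite size_map.
apply: leq_trans (_ : size g <= _); last exact: size_poly.
apply: ltnW; apply: max_poly_roots => //.
  apply/allP => _ /mapP[a + ->]; rewrite mem_filter => /andP[qa _].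
  rewrite /root -[a%:R%R]/((a%:Z)%:~R)%R horner_map -(dvdz_pcharf cq).
  by rewrite dvdzE.
rewrite map_inj_in_uniq ?filter_uniq ?iota_uniq // => a b.
rewrite !mem_filter !mem_iota /= => /andP[_ aq] /andP[_ bq] /(congr1 val).
by rewrite /= !val_Fp_nat // !modn_small.
Qed.

(** By the Chinese remainder theorem, reduction modulo [k] and [q] embeds the roots into the pairs
    of roots. *)
Lemma count_roots_coprime (f : {poly int}) k q : 0 < k -> 0 < q -> coprime k q ->
  count (fun a => k * q %| poly_absz f a) (iota 0 (k * q)) <=
  count (fun a => k %| poly_absz f a) (iota 0 k) *
  count (fun a => q %| poly_absz f a) (iota 0 q).
Proof.
move=> k0 q0 co; rewrite -!size_filter -(size_allpairs pair).
pose h a := (a %% k, a %% q).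
rewrite -(size_map h); apply: uniq_leq_size.
  rewrite map_inj_in_uniq ?filter_uniq ?iota_uniq // => a b.
  rewrite !mem_filter !mem_iota /= => /andP[_ ak] /andP[_ bk] [e1 e2].
  have : a == b %[mod k * q] by rewrite chinese_remainder // e1 e2 !eqxx.
  by rewrite !modn_small // => /eqP.
move=> _ /mapP[a + ->]; rewrite mem_filter Gauss_dvd // => /andP[/andP[ka qa] _].
apply: allpairs_f; rewrite mem_filter dvdn_poly_absz_mod mem_iota /= add0n ltn_mod.
  by rewrite ka k0.
by rewrite qa q0.
Qed.

Lemma count_roots_prod_primes (f : {poly int}) (ks : seq nat) :
  zcontents f = 1%R -> uniq ks -> all prime ks ->
  count (fun a => \prod_(q <- ks) q %| poly_absz f a) (iota 0 (\prod_(q <- ks) q))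
    <= size f ^ size ks.
Proof.
move=> fp; elim: ks => [|q ks IHks]; first by rewrite big_nil /= dvd1n.
move=> /= /andP[qks uks] /andP[pq pks]; rewrite big_cons expnS.
apply: leq_trans (leq_mul (count_roots_prime fp pq) (IHks uks pks)).
have P0 : 0 < \prod_(j <- ks) j.
  by rewrite big_seq prodn_cond_gt0 // => j /(allP pks) /prime_gt0.
apply: count_roots_coprime => //; first exact: prime_gt0.
rewrite big_seq; elim/big_rec: _ => [|j x sj cx]; first by rewrite coprimen1.
rewrite coprimeMr cx andbT prime_coprime // dvdn_prime2 ?(allP pks j) //.
by apply: contraNneq qks => ->.
Qed.

Lemma count_dvdn_leq_sum_classes (f : {poly int}) k (s : seq nat) : 0 < k ->
  count (fun p => k %| poly_absz f p) s <=
  \sum_(a <- [seq a <- iota 0 k | k %| poly_absz f a]) count (fun p => p %% k == a) s.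
Proof.
move=> k0; elim: s => [|p s IHs] //=.
rewrite big_split /= leq_add //; case: (boolP (k %| _)) => // kp.
rewrite (big_rem (p %% k)) /= ?eqxx // mem_filter dvdn_poly_absz_mod kp.
by rewrite mem_iota /= ltn_mod.
Qed.

(** Within one class the quotient by [k] determines the integer. *)
Lemma count_class_leq k a n : 0 < k ->
  count (fun p => p %% k == a) (nprimes n) <= (n %/ k).+1.
Proof.
move=> k0; rewrite -size_filter -(size_map (fun p => p %/ k)).
rewrite -[X in _ <= X](size_iota 0); apply: uniq_leq_size.
  rewrite map_inj_in_uniq ?filter_uniq ?iota_uniq // => p q.
  rewrite !mem_filter => /andP[/eqP pa _] /andP[/eqP qa _] e.
  by rewrite (divn_eq p k) (divn_eq q k) e pa qa.
move=> _ /mapP[p + ->]; rewrite mem_filter mem_nprimes => /and3P[_ _ pn].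
by rewrite mem_iota /= add0n ltnS leq_div2r.
Qed.

(** The gcd of [k] and [a] divides every prime of the class; not being 1, it equals that prime. *)
Lemma count_class_ncoprime k a n : ~~ coprime k a ->
  count (fun p => p %% k == a) (nprimes n) <= 1.
Proof.
move=> co; rewrite -size_filter.
have h p : p \in [seq p <- nprimes n | p %% k == a] -> p = gcdn k a.
  rewrite mem_filter mem_nprimes => /and3P[/eqP pa pp _].
  have : gcdn k a %| p by rewrite -pa gcdn_modr dvdn_gcdr.
  have /primeP[_ dv] := pp => /dv /orP[|/eqP //].
  by rewrite -/(coprime k a) (negbTE co).
set s := [seq _ <- _ | _] in h *.
have : uniq s by rewrite filter_uniq ?nprimes_uniq.
case: s h => [|x [|y s]] // h /=.
by rewrite (h x) ?mem_head // (h y) ?inE ?eqxx ?orbT.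
Qed.

Local Open Scope ring_scope.

(** * Primes in residue classes *)

Lemma lnX (R : realType) (x : R) n : 0 < x -> ln (x ^+ n) = n%:R * ln x.
Proof. by move=> x0; rewrite lnXn // mulr_natl. Qed.

Lemma size_ln_leq (R : realType) (s : seq nat) (y : R) (B : nat) :
  0 < y -> {in s, forall p, y <= p%:R} -> (\prod_(p <- s) p <= B)%N ->
  (size s)%:R * ln y <= ln B%:R.
Proof.
move=> y0 ys sB.
have le : y ^+ size s <= (\prod_(p <- s) p)%:R.
  elim: s ys {sB} => [|p s IHs] ys /=; first by rewrite big_nil expr0.
  rewrite big_cons exprS natrM ler_pM ?exprn_ge0 ?(ltW y0) ?ys ?mem_head //.
  by apply: IHs => q qs; rewrite ys // in_cons qs orbT.
rewrite -lnX // ler_ln ?posrE ?exprn_gt0 //.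
  by rewrite (le_trans le) ?ler_nat.
by rewrite (lt_le_trans (exprn_gt0 (size s) y0)) ?(le_trans le) ?ler_nat.
Qed.

(** Chebyshev's lower bound, from the central binomial coefficient; the 4 comes from n <= 4
    [n/2]. *)
Lemma nprimes_ge (R : realType) (n : nat) : (1 < n)%N ->
  n%:R * ln 2 <= 4 * (size (nprimes n))%:R * ln n%:R :> R.
Proof.
move=> n1; pose m := n./2.
have mn : (m.*2 <= n)%N by rewrite /m; lia.
have h : (2 ^ m <= n ^ size (nprimes n))%N.
  apply: leq_trans (leq_bin2n m) _.
  apply: leq_trans (_ : 'C(n, m) <= _)%N.
    by apply: leq_bin2l.
  by apply: bin_leq_expn_primes; lia.
have n0N : (0 < n)%N by exact: ltnW.
have n0 : 0 < n%:R :> R by rewrite ltr0n.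
have : ln ((2 ^ m)%:R : R) <= ln (n ^ size (nprimes n))%:R.
  by rewrite ler_ln ?posrE ?ltr0n ?expn_gt0 ?n0N ?ler_nat.
rewrite !natrX !lnX // => h2.
have m4 : n%:R <= 4 * m%:R :> R by rewrite -natrM ler_nat /m; lia.
have l2 : 0 <= ln 2 :> R by rewrite ln_ge0 // ler1n.
by nra.
Qed.

Lemma count_leq_real (R : realType) (s : seq nat) (y : R) :
  uniq s -> 0 <= y -> {in s, forall p, (0 < p)%N && (p%:R <= y)} -> (size s)%:R <= y.
Proof.
move=> us y0 h; rewrite -truncn_ge_nat //.
rewrite -[leqRHS](size_iota 1); apply: uniq_leq_size => // p /h.
by rewrite mem_iota add1n ltnS truncn_ge_nat.
Qed.

(** The primes are cut at [z] and at [m]. Up to [z] they are counted trivially, between [z] and [m]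
    by the primorial bound without regard to the class, and above [m] by the progression bound. Each
    prime above [z] weighs at least half of [ln n]. *)
Lemma count_class_coprime (R : realType) k a n :
  (0 < k)%N -> (a < k)%N -> coprime k a -> (k * k <= n)%N -> (1 < n)%N ->
  (count (fun p => p %% k == a)%N (nprimes n))%:R * ln n%:R <=
  Num.sqrt n%:R * ln n%:R + n%:R / k%:R * (10 + 4 * ln k%:R) :> R.
Proof.
move=> k0 ak co kn n1; set m := (n %/ k)%N; set z : R := Num.sqrt n%:R.
have n0R : 0 < n%:R :> R by rewrite ltr0n; lia.
have z0 : 0 < z by rewrite sqrtr_gt0.
have lnz : ln (n%:R : R) = 2 * ln z.
  by rewrite -[in LHS](sqr_sqrtr (ltW n0R)) lnX //.
have km : (k <= m)%N by rewrite /m leq_divRL.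
have nm : (n < m.+1 * k)%N by rewrite /m ltn_ceil.
pose S0 := [seq p <- nprimes m | p%:R <= z].
pose S1 := [seq p <- nprimes m | z < p%:R].
pose S2 := [seq p <- nprimes n | (p %% k == a) && (m < p)]%N.
have cnt : (count (fun p => p %% k == a) (nprimes n) <= size S0 + size S1 + size S2)%N.
  have -> : (size S0 + size S1 = size (nprimes m))%N.
    rewrite [size S0]size_filter [size S1]size_filter.
    rewrite -[RHS](count_predC (fun p => p%:R <= z)); congr addn.
    by apply: eq_count => p /=; rewrite ltNge.
  rewrite -size_filter -(count_predC (fun p => p <= m)%N).
  apply: leq_add.
    rewrite -size_filter; apply: uniq_leq_size => [|p].
      by rewrite !filter_uniq ?iota_uniq.
    by rewrite mem_filter mem_filter !mem_nprimes => /and4P[-> _ ->].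
  rewrite count_filter size_filter; apply/eq_leq/eq_count => p /=.
  by rewrite -ltnNge andbC.
have b0 : (size S0)%:R <= z.
  apply: count_leq_real; rewrite ?filter_uniq ?iota_uniq ?(ltW z0) // => p.
  by rewrite !mem_filter => /and3P[-> /prime_gt0 ->].
have b1 : (size S1)%:R * ln z <= ln (2 ^ (4 * m))%:R.
  apply: size_ln_leq => // [p|]; first by rewrite mem_filter => /andP[/ltW].
  apply: leq_trans (primorial_leq m).
  rewrite /S1 big_filter -(big_filter _ prime) -/(nprimes m).
  rewrite [leqRHS](bigID (fun p : nat => z < p%:R)) /=.
  rewrite leq_pmulr // big_seq_cond prodn_cond_gt0 // => p.
  by rewrite mem_nprimes -andbA => /and3P[/prime_gt0].
have b2 : (size S2)%:R * ln z <= ln ((2 * k ^ 2) ^ m)%:R.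
  apply: size_ln_leq => // [p|].
    rewrite mem_filter => /andP[/andP[_ mp] _].
    (* Since k <= m, p^2 >= (m + 1)^2 > (m + 1) k > n, so these primes exceed [z] as well. *)
    rewrite -(@ler_pXn2r _ 2) ?nnegrE ?ler0n ?(ltW z0) // sqr_sqrtr ?(ltW n0R) //.
    rewrite -natrX ler_nat; nia.
  apply: (@prod_primes_progression k a m) => //.
    by rewrite filter_uniq ?nprimes_uniq.
  move=> p; rewrite mem_filter mem_nprimes => /andP[/andP[/eqP pa mp] /andP[pp pn]].
  split => //; rewrite /m leq_div2r // andbT divn_gt0 //; lia.
have k0R : 0 < k%:R :> R by rewrite ltr0n.
have lk : 0 <= ln k%:R :> R by rewrite ln_ge0 // ler1n.
have l2 : ln 2 <= 1 :> R by have := @le_ln1Dx R 1; rewrite -[1 + 1]/2; apply; lra.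
move: b1 b2; rewrite !natrX natrM natrX.
rewrite !lnX ?mulr_gt0 ?exprn_gt0 ?ltr0n // lnM ?posrE ?exprn_gt0 // lnX //.
rewrite natrM => b1 b2.
have mk : m%:R <= n%:R / k%:R :> R.
  by rewrite ler_pdivlMr // -natrM ler_nat /m leq_divM.
have lnn : 0 <= ln n%:R :> R by rewrite ln_ge0 // ler1n; lia.
apply: le_trans (_ : ((size S0)%:R + (size S1)%:R + (size S2)%:R) * ln n%:R <= _).
  by rewrite ler_wpM2r // -!natrD ler_nat.
rewrite !mulrDl -addrA lerD //; first by rewrite ler_wpM2r.
(* The factor 2 in [lnz] doubles the bounds 4 m ln 2 and m (ln 2 + 2 ln k); with ln 2 <= 1 this
   yields 10 and 4. *)
rewrite lnz; move: (n%:R / k%:R) mk => u mk.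
have m0 : 0 <= m%:R :> R by [].
have e1 : 0 <= (u - m%:R) * ln k%:R by rewrite mulr_ge0 // subr_ge0.
have e2 : 0 <= m%:R * (1 - ln 2) :> R by rewrite mulr_ge0 // subr_ge0.
by lra.
Qed.

(** With w = n^(1/4), Chebyshev's bound and ln n = 4 ln w <= 4 w give w^3 ln 2 <= 16 pi(n). *)
Lemma sqrtn_leq_nprimes (R : realType) n : (1 < n)%N ->
  Num.sqrt n%:R <= 16 / ln 2 * (size (nprimes n))%:R / Num.sqrt (Num.sqrt n%:R) :> R.
Proof.
move=> n1; have n0R : 0 < n%:R :> R by rewrite ltr0n; lia.
set w : R := Num.sqrt (Num.sqrt n%:R).
have w0 : 0 < w by rewrite !sqrtr_gt0.
have e2 : Num.sqrt n%:R = w ^+ 2 by rewrite sqr_sqrtr // sqrtr_ge0.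
have e4 : n%:R = w ^+ 4 by rewrite (exprM _ 2 2) -e2 sqr_sqrtr // ltW.
have := nprimes_ge R n1; rewrite e2 e4 lnX //.
have l2 : 0 < ln 2 :> R by rewrite ln_gt0 // ltr1n.
have lw := ln_sublinear w0.
set P : R := (size _)%:R => h.
have P0 : 0 <= P by rewrite /P.
rewrite ler_pdivlMr // [leRHS]mulrAC ler_pdivlMr //.
have : w * (w ^+ 2 * w * ln 2) <= w * (16 * P).
  apply: le_trans (_ : 4 * P * (4 * ln w) <= _).
    by apply: le_trans h; rewrite le_eqVlt; apply/orP; left; apply/eqP; ring.
  have : P * ln w <= P * w by rewrite ler_wpM2l // ltW.
  lra.
by rewrite ler_pM2l.
Qed.

(** Half of the exponent of [k] is given up to absorb the factor ln k and to cover the classes not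
    coprime to [k]. *)
Lemma count_class_leq_sqrt (R : realType) k a n :
  (0 < k)%N -> (a < k)%N -> (k * k <= n)%N -> (1 < n)%N ->
  (count (fun p => p %% k == a)%N (nprimes n))%:R <=
  88 / ln 2 * (size (nprimes n))%:R / Num.sqrt k%:R :> R.
Proof.
move=> k0 ak kn n1.
have n0R : 0 < n%:R :> R by rewrite ltr0n; lia.
have k0R : 0 < k%:R :> R by rewrite ltr0n.
have l2 : 0 < ln 2 :> R by rewrite ln_gt0 // ltr1n.
have ln0 : 0 < ln n%:R :> R by rewrite ln_gt0 // ltr1n.
set P : R := (size _)%:R; have P0 : 0 <= P by rewrite /P.
set r : R := Num.sqrt k%:R; have r0 : 0 < r by rewrite sqrtr_gt0.
have er : k%:R = r ^+ 2 by rewrite sqr_sqrtr // ltW.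
(* As k^2 <= n, the root [r] of [k] is at most n^(1/4). *)
have sq : Num.sqrt n%:R <= 16 / ln 2 * P / r.
  apply: le_trans (sqrtn_leq_nprimes R n1) _.
  rewrite ler_wpM2l ?mulr_ge0 ?invr_ge0 ?(ltW l2) //.
  rewrite lef_pV2 ?posrE ?sqrtr_gt0 // ler_sqrt ?sqrtr_ge0 //.
  by rewrite -(@ler_pXn2r _ 2) ?nnegrE ?sqrtr_ge0 // sqr_sqrtr ?(ltW n0R) // -natrX ler_nat.
case: (boolP (coprime k a)) => [co|nco].
  have := count_class_coprime R k0 ak co kn n1.
  rewrite -(ler_pdivlMr _ _ ln0) => h; apply: le_trans h _.
  rewrite mulrDl mulfK ?gt_eqF //.
  (* The 16 pays for the square root of [n]. The 72 is 4 times 18: 10 + 4 ln k <= 18 r, and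
     Chebyshev's bound costs a factor 4. *)
  have -> : 88 / ln 2 * P / r = 16 / ln 2 * P / r + 72 / ln 2 * P / r.
    by rewrite -!mulrDl; congr (_ / _ * _ / _); ring.
  rewrite lerD // ler_pdivrMr // er.
  have lr : ln (r ^+ 2) <= 2 * r.
    by rewrite lnX // ler_pM2l // ltW // ln_sublinear.
  have r1 : 1 <= r by rewrite -[leLHS]sqrtr1 ler_sqrt // ler1n.
  apply: le_trans (_ : n%:R / r ^+ 2 * (18 * r) <= _).
    by rewrite ler_wpM2l ?divr_ge0 ?exprn_ge0 ?(ltW r0) //; lra.
  have -> : n%:R / r ^+ 2 * (18 * r) = 18 * (n%:R * ln 2) / (ln 2 * r).
    by field; rewrite !gt_eqF.
  have -> : 72 / ln 2 * P / r * ln n%:R = 18 * (4 * P * ln n%:R) / (ln 2 * r).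
    by field; rewrite !gt_eqF.
  rewrite ler_pM2r ?invr_gt0 ?mulr_gt0 // ler_pM2l //.
  exact: nprimes_ge.
apply: le_trans (_ : Num.sqrt n%:R <= _).
  apply: le_trans (_ : 1 <= _); first by rewrite lern1 count_class_ncoprime.
  by rewrite -[leLHS]sqrtr1 ler_sqrt // ler1n ltnW.
apply: le_trans sq _; rewrite ler_pM2r ?invr_gt0 // ler_wpM2r // ler_pM2r ?invr_gt0 //.
by rewrite ler_nat.
Qed.

(** * Mertens' theorem *)

Lemma ln_prod (R : realType) (I : Type) (r : seq I) (P : pred I) (F : I -> R) :
  (forall i, P i -> 0 < F i) ->
  ln (\prod_(i <- r | P i) F i) = \sum_(i <- r | P i) ln (F i).
Proof.
move=> F0; suff [] : 0 < \prod_(i <- r | P i) F i /\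
    ln (\prod_(i <- r | P i) F i) = \sum_(i <- r | P i) ln (F i) by [].
elim/big_rec2: _ => [|i x y Pi [y0 e]]; first by rewrite ln1.
by rewrite mulr_gt0 ?F0 // lnM ?posrE ?F0 // e.
Qed.

(** Multiply by [n] and use n/p <= [n/p] + 1. The product of the p^[n/p] divides n! <= n^n, and the
    remaining sum of ln p is the logarithm of the primorial. *)
Lemma sum_ln_div_prime_leq (R : realType) n : (0 < n)%N ->
  \sum_(0 <= p < n.+1 | prime p) ln p%:R / p%:R <= ln n%:R + 4 * ln 2 :> R.
Proof.
move=> n0; have n0R : 0 < n%:R :> R by rewrite ltr0n.
rewrite -(ler_pM2l n0R) mulrDr mulr_sumr.
have p0 p : prime p -> 0 < p%:R :> R by move=> /prime_gt0; rewrite ltr0n.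
have lnp p : prime p -> 0 <= ln p%:R :> R.
  by move=> /prime_gt0 h; rewrite ln_ge0 // ler1n.
apply: le_trans (_ : \sum_(0 <= p < n.+1 | prime p) ((n %/ p)%:R * ln p%:R + ln p%:R) <= _).
  apply: ler_sum => p pp; rewrite mulrCA mulrC -[X in _ + X]mul1r -mulrDl.
  rewrite ler_wpM2r ?lnp // ler_pdivrMr ?p0 // natr1 -natrM ler_nat.
  by rewrite ltnW // ltn_ceil // prime_gt0.
rewrite big_split /= lerD //.
  have e : \sum_(0 <= p < n.+1 | prime p) (n %/ p)%:R * ln p%:R
     = ln (\prod_(0 <= p < n.+1 | prime p) p ^ (n %/ p))%:R :> R.
    rewrite natr_prod ln_prod => [|p /prime_gt0 h].
      by apply: eq_bigr => p /p0 h; rewrite natrX lnX.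
    by rewrite ltr0n expn_gt0 h.
  rewrite e -lnX // -natrX ler_ln ?posrE ?ltr0n ?expn_gt0 ?n0 //; last first.
    by rewrite prodn_cond_gt0 // => p /prime_gt0 h; rewrite expn_gt0 h.
  rewrite ler_nat; apply: leq_trans (_ : n`! <= _)%N.
    apply: dvdn_leq; first exact: fact_gt0.
    rewrite -big_filter -/(nprimes n).
    apply: prod_dvdn_coprime (nprimes_uniq n) _ _ => [p q|p].
      rewrite !mem_nprimes => /andP[pp _] /andP[pq _] ne.
      by rewrite coprimeXl ?coprimeXr // prime_coprime // dvdn_prime2.
    rewrite mem_nprimes => /andP[pp _].
    by rewrite pfactor_dvdn ?fact_gt0 // leq_logn_fact.
  rewrite fact_prod.
  have -> : (n ^ n = \prod_(1 <= i < n.+1) n)%N by rewrite prod_nat_const_nat subn1.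
  by rewrite !big_nat; apply: leq_prod => i /andP[].
rewrite -ln_prod // -natr_prod.
have -> : n%:R * (4 * ln 2) = ln (2 ^ (4 * n))%:R :> R.
  by rewrite natrX lnX // natrM; ring.
rewrite ler_ln ?posrE ?ltr0n ?expn_gt0 // ?ler_nat ?primorial_leq //.
by rewrite prodn_cond_gt0 // => p /prime_gt0.
Qed.

(* Abel summation: B n := S n - A n / ln n, where S and A are the sums of 1/p and of ln p / p,
   satisfies B (n + 1) - B n = A n (1 / ln n - 1 / ln (n + 1)). *)
Lemma sum_inv_prime_leq (R : realType) : exists K : R, forall n, (1 < n)%N ->
  \sum_(0 <= p < n.+1 | prime p) p%:R^-1 <= ln (ln n%:R) + K.
Proof.
pose S n : R := \sum_(0 <= p < n.+1 | prime p) p%:R^-1.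
pose A n : R := \sum_(0 <= p < n.+1 | prime p) ln p%:R / p%:R.
(* [K] makes the inequality [B] below an equality at n = 2. *)
pose c : R := 4 * ln 2; pose K := c / ln 2 - ln (ln 2) + S 2 - A 2 / ln 2.
have l0 n : (1 < n)%N -> 0 < ln n%:R :> R by move=> n1; rewrite ln_gt0 // ltr1n.
have c0 : 0 <= c by rewrite /c mulr_ge0 // ltW // l0.
suff B n : (1 < n)%N -> S n - A n / ln n%:R <= ln (ln n%:R) - c / ln n%:R + K.
  exists (1 + K) => n n1; rewrite -/(S n).
  have := B n n1; have : A n / ln n%:R <= 1 + c / ln n%:R.
    rewrite ler_pdivrMr ?l0 // mulrDl mul1r divfK ?gt_eqF ?l0 //.
    by apply: sum_ln_div_prime_leq; lia.
  by lra.
elim: n => // n IHn; rewrite ltnS leq_eqVlt => /orP[/eqP <-|n1].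
  by rewrite /K; lra.
have {IHn} := IHn n1.
have ln0 := l0 _ n1; have ln0' := l0 n.+1 (ltnW n1).
have An : A n <= ln n%:R + c by apply: sum_ln_div_prime_leq; lia.
have -> : S n.+1 = S n + (prime n.+1)%:R / n.+1%:R.
  rewrite /S big_mkcond big_nat_recr //= -big_mkcond /=; congr (_ + _).
  by case: (prime _); rewrite ?mul1r ?mul0r.
have -> : A n.+1 = A n + (prime n.+1)%:R / n.+1%:R * ln n.+1%:R.
  rewrite /A big_mkcond big_nat_recr //= -big_mkcond /=; congr (_ + _).
  by case: (prime _); rewrite ?mul1r ?mul0r // mulrC.
rewrite mulrDl mulfK ?gt_eqF //.
set l := ln n%:R in An ln0 *; set l' := ln n.+1%:R in ln0' *.
have ll : l <= l' by rewrite ler_ln ?posrE ?ltr0n ?ler_nat // ltnW.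
have V : l'^-1 <= l^-1 by rewrite lef_pV2.
have : A n * (l^-1 - l'^-1) <= (l + c) * (l^-1 - l'^-1) by rewrite ler_wpM2r // subr_ge0.
have -> : (l + c) * (l^-1 - l'^-1) = 1 - l / l' + c / l - c / l'.
  by field; rewrite !gt_eqF.
(* This bounds the increment 1 - l/l' by ln l' - ln l, which telescopes to ln ln n. *)
have : ln (l / l') <= l / l' - 1.
  have := @le_ln1Dx R (l / l' - 1); rewrite addrCA subrr addr0; apply.
  by rewrite ltrBrDr addNr divr_gt0.
rewrite ln_div ?posrE // mulrBr.
move: (S n) (A n / l) (A n / l') (l / l') (c / l) (c / l') (_ / n.+1%:R) K => *.
by lra.
Qed.

(** Since p/(p - 1) = 1 + 1/p + 1/(p (p - 1)), the product is at most the exponential of the sum of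
    1/p plus a telescoping sum bounded by 1. *)
Lemma prod_inv_prime_leq (R : realType) : exists2 K : R, 1 <= K & forall n, (1 < n)%N ->
  \prod_(0 <= p < n.+1 | prime p) (p%:R / p.-1%:R) <= K * ln n%:R.
Proof.
have [K HK] := sum_inv_prime_leq R.
exists (expR (`|K| + 1)) => [|n n1]; first by rewrite -[leLHS]expR0 ler_expR addr_ge0.
have l0 : 0 < ln n%:R :> R by rewrite ln_gt0 // ltr1n.
have tel : \sum_(2 <= p < n.+1) (p%:R * p.-1%:R)^-1 = 1 - n%:R^-1 :> R.
  elim: n n1 {l0} => // n IHn; rewrite ltnS leq_eqVlt => /orP[/eqP <-|n1].
    by rewrite big_nat1 /=; field.
  rewrite big_nat_recr /= ?IHn //; last exact: ltnW.
  have a0 : n%:R != 0 :> R by rewrite pnatr_eq0 -lt0n ltnW.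
  by field; rewrite a0 nat1r pnatr_eq0.
apply: le_trans (_ : expR (\sum_(0 <= p < n.+1 | prime p)
    (p%:R^-1 + (p%:R * p.-1%:R)^-1)) <= _).
  rewrite expR_sum; apply: ler_prod => p pp; rewrite divr_ge0 //=.
  have p1 := prime_gt1 pp.
  apply: le_trans (expR_ge1Dx _).
  have e : p%:R = p.-1%:R + 1 :> R by rewrite natr1 prednK // ltnW.
  have q0 : 0 < p.-1%:R :> R by rewrite ltr0n; lia.
  rewrite e le_eqVlt; apply/orP; left; apply/eqP.
  by field; rewrite !gt_eqF // ltr_wpDl // ltW.
rewrite -[X in _ * X]lnK ?posrE // -expRD ler_expR big_split /=.
have : \sum_(0 <= p < n.+1 | prime p) (p%:R * p.-1%:R)^-1 <= 1 :> R.
  apply: le_trans (_ : \sum_(2 <= p < n.+1) (p%:R * p.-1%:R)^-1 <= _ :> R).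
    rewrite (@big_cat_nat _ _ _ 2) //=; last lia.
    rewrite big_nat_cond big1 ?add0r => [|p /andP[p2 /prime_gt1]]; last by lia.
    rewrite [leRHS](bigID prime) /= lerDl sumr_ge0 // => p _.
    by rewrite invr_ge0 mulr_ge0.
  by rewrite tel gerBl invr_ge0.
have := HK n n1; have := ler_norm K; lra.
Qed.

Lemma powR_expR (R : realType) (x a : R) : 0 < x -> x `^ a = expR (a * ln x).
Proof. by move=> x0; rewrite /powR gt_eqF. Qed.

(** A telescoping form of the comparison with the integral of x^(-1-d): the term at v is at most ((v
    - 1)^(-d) - v^(-d)) / d, because - ln (1 - 1/v) >= 1/v. *)
Lemma sum_inv_powR_leq (R : realType) (d : R) n : 0 < d ->
  \sum_(2 <= q < n.+1) q%:R^-1 * q%:R `^ (- d) <= d^-1.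
Proof.
move=> d0; have d1 : 0 < d^-1 by rewrite invr_gt0.
case: n => [|n]; first by rewrite big_geq // ltW.
suff : \sum_(2 <= q < n.+2) q%:R^-1 * q%:R `^ (- d) <= d^-1 * (1 - n.+1%:R `^ (- d)).
  move=> /le_trans; apply; rewrite -[leRHS]mulr1 ler_pM2l // gerBl.
  exact: powR_ge0.
elim: n => [|n IHn]; first by rewrite big_geq // powR1 subrr mulr0.
rewrite big_nat_recr //=; set u := n.+1%:R in IHn *; set v := n.+2%:R.
have u0 : 0 < u by rewrite ltr0n.
have v0 : 0 < v by rewrite ltr0n.
have uv : u = v - 1 by rewrite /u /v -[n.+2]addn1 natrD addrK.
suff : v^-1 * v `^ (- d) <= d^-1 * (u `^ (- d) - v `^ (- d)).
  move: IHn; rewrite !mulrBr.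
  move: (d^-1 * 1) (d^-1 * u `^ _) (d^-1 * v `^ _) (v^-1 * _) => *; lra.
rewrite -(ler_pM2l d0) mulrA mulVKf ?gt_eqF //.
have -> : u `^ (- d) = v `^ (- d) * expR (- d * ln (u / v)).
  by rewrite !powR_expR // -expRD ln_div ?posrE // mulrBr addrC subrK.
suff : 1 + d * v^-1 <= expR (- d * ln (u / v)).
  move=> h; rewrite -[X in _ - X]mulr1 -mulrBr [leLHS]mulrC.
  by rewrite ler_wpM2l ?powR_ge0 // lerBrDl.
apply: le_trans (expR_ge1Dx _); rewrite lerD2l mulNr -mulrN ler_pM2l //.
have := @le_ln1Dx R (- v^-1).
have -> : 1 + - v^-1 = u / v by rewrite uv mulrBl mulfV ?gt_eqF // mul1r.
have v1 : v^-1 < 1 by rewrite invf_lt1 // ltr1n.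
by rewrite lerNr; apply; rewrite ltrN2.
Qed.

(** * Moments *)

Lemma poly_absz_leq (f : {poly int}) n : (0 < n)%N ->
  (poly_absz f n <= (\sum_(i < size f) absz (f`_i)%R).+1 * n ^ size f)%N.
Proof.
move=> n0; rewrite /poly_absz horner_coef.
apply: leq_trans (_ : (\sum_(i < size f) absz (f`_i)%R) * n ^ size f <= _)%N; last first.
  by rewrite leq_mul2r leqnSn orbT.
rewrite big_distrl /=; elim/big_ind2: _ => // [x1 x2 y1 y2|i _]; first by lia.
by rewrite abszM abszX leq_mul2l leq_pexp2l ?orbT // ltnW.
Qed.

Lemma prod_mulr_powR (R : realType) (ks : seq nat) (c d : R) :
  \prod_(q <- ks) (c * q%:R `^ d) = c ^+ size ks * (\prod_(q <- ks) q)%:R `^ d.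
Proof.
elim: ks => [|q ks IHks]; first by rewrite !big_nil powR1 mulr1.
by rewrite !big_cons IHks natrM powRM // exprS; ring.
Qed.

(** The list [ks] encodes a squarefree modulus; at most [size f ^ size ks] classes consist of roots,
    and [W] bounds each of them. *)
Lemma count_dvdn_leq (R : realType) (f : {poly int}) (ks : seq nat) (s : seq nat) (W : R) :
  zcontents f = 1 -> uniq ks -> all prime ks ->
  (forall a, (a < \prod_(q <- ks) q)%N ->
    (count (fun p => p %% (\prod_(q <- ks) q) == a)%N s)%:R <= W) -> 0 <= W ->
  (count (fun p => all (fun q => q %| poly_absz f p)%N ks) s)%:R
    <= (size f)%:R ^+ size ks * W.
Proof.
move=> fp uks pks hW W0; set K := (\prod_(q <- ks) q)%N in hW *.
have K0 : (0 < K)%N.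
  by rewrite /K big_seq prodn_cond_gt0 // => j /(allP pks) /prime_gt0.
have -> : count (fun p => all (fun q => q %| poly_absz f p)%N ks) s =
          count (fun p => K %| poly_absz f p)%N s.
  by apply: eq_count => p; rewrite /K prod_primes_dvdn.
apply: le_trans (_ : (\sum_(a <- [seq a <- iota 0 K | K %| poly_absz f a])
    count (fun p => p %% K == a) s)%N%:R <= _).
  by rewrite ler_nat count_dvdn_leq_sum_classes.
rewrite natr_sum big_seq.
apply: le_trans (_ : \sum_(a <- [seq a <- iota 0 K | K %| poly_absz f a]%N) W <= _).
  rewrite [leRHS]big_seq; apply: ler_sum => a; rewrite mem_filter mem_iota => /and3P[_ _ ak].
  exact: hW.
rewrite big_const_seq count_predT iter_addr_0 -[W *+ _]mulr_natl ler_wpM2r // -natrX ler_nat.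
by rewrite size_filter count_roots_prod_primes.
Qed.

(** The exponent d = 1/(4D) suits both ranges: d <= 1/2 for moduli up to the square root of [n], and
    D d = 1/4 beyond. *)
Lemma count_all_dvd_leq (R : realType) (f : {poly int}) : zcontents f = 1 ->
  (forall p, prime p -> (0 < poly_absz f p)%N) ->
  exists2 M : R, 0 < M & forall (n : nat) (ks : seq nat),
    (1 < n)%N -> uniq ks -> all prime ks ->
    (count (fun p => all (fun q => q %| poly_absz f p)%N ks) (nprimes n))%:R <=
    M * (size (nprimes n))%:R *
      \prod_(q <- ks) ((size f)%:R * q%:R `^ (- (4 * (size f)%:R)^-1)).
Proof.
move=> fp fpos; set D := size f; set d : R := (4 * D%:R)^-1.
pose B := (\sum_(i < size f) absz (f`_i)%R)%N.+1.
have D1 : (0 < D)%N.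
  by rewrite lt0n size_poly_eq0; apply: contra_eq_neq fp => ->; rewrite zcontents0.
have D0 : 0 < D%:R :> R by rewrite ltr0n.
have d0 : 0 < d by rewrite invr_gt0 mulr_gt0.
have Dd : D%:R * d = 4^-1 by rewrite /d; field; rewrite gt_eqF.
have l2 : 0 < ln 2 :> R by rewrite ln_gt0 // ltr1n.
(* The first summand serves K^2 <= n, the second K^2 > n. *)
pose M := 88 / ln 2 + 32 / ln 2 * B%:R `^ d.
have M0 : 0 < M.
  by rewrite ltr_pwDl ?divr_gt0 // mulr_ge0 ?powR_ge0 // divr_ge0 // ltW.
exists M => // n ks n1 uks pks; set P : R := (size _)%:R.
have P0 : 0 <= P by rewrite /P.
rewrite prod_mulr_powR; set K := (\prod_(q <- ks) q)%N.
have K0 : (0 < K)%N.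
  by rewrite /K big_seq prodn_cond_gt0 // => j /(allP pks) /prime_gt0.
have K0R : 0 < K%:R :> R by rewrite ltr0n.
have n0R : 0 < n%:R :> R by rewrite ltr0n ltnW.
have Kd : 0 <= K%:R `^ (- d) by exact: powR_ge0.
have Bd : 0 <= B%:R `^ d by exact: powR_ge0.
(* If the count is not zero, [K] divides some nonzero value at a prime p <= n, so that K <= B
   n^D. *)
have [/eqP -> |] :=
  boolP (count (fun p => all (fun q => q %| poly_absz f p)%N ks) (nprimes n) == 0%N).
  by rewrite !mulr_ge0 ?exprn_ge0 ?(ltW D0) ?(ltW M0).
rewrite -lt0n -has_count => /hasP[p pn dvp].
have Kn : (K <= B * n ^ D)%N.
  move: pn; rewrite mem_nprimes => /andP[pp pn].
  apply: leq_trans (_ : poly_absz f p <= _)%N.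
    by apply: dvdn_leq; rewrite ?fpos // /K prod_primes_dvdn.
  apply: leq_trans (poly_absz_leq f (prime_gt0 pp)) _.
  by rewrite leq_mul2l leq_exp2r ?pn ?orbT.
suff [W [W0 hW WM]] : exists W : R, [/\ 0 <= W,
    forall a, (a < K)%N -> (count (fun p => p %% K == a)%N (nprimes n))%:R <= W &
    W <= M * P * K%:R `^ (- d)].
  apply: le_trans (count_dvdn_leq fp uks pks hW W0) _.
  by rewrite mulrCA ler_wpM2l // exprn_ge0 // ltW.
have [KK|KK] := leqP (K * K) n.
  exists (88 / ln 2 * P / Num.sqrt K%:R); split.
  - by rewrite divr_ge0 ?mulr_ge0 ?sqrtr_ge0 // invr_ge0 ltW.
  - by move=> a aK; apply: count_class_leq_sqrt.
  apply: ler_pM => //; rewrite ?mulr_ge0 ?invr_ge0 ?sqrtr_ge0 ?(ltW l2) //.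
    by rewrite ler_wpM2r // lerDl !mulr_ge0 // invr_ge0 ltW.
  rewrite -powR12_sqrt ?(ltW K0R) // -powRN ler_powR ?ler1n // lerN2.
  rewrite /d lef_pV2 ?posrE ?mulr_gt0 //.
  have : 1 <= D%:R :> R by rewrite ler1n.
  by lra.
have n1R : 1 <= Num.sqrt n%:R :> R by rewrite -[leLHS]sqrtr1 ler_sqrt // ler1n ltnW.
(* For K^2 > n both terms of n/K + 1 are at most the square root of [n]. *)
exists (2 * Num.sqrt n%:R); split; first by rewrite mulr_ge0 ?sqrtr_ge0.
  move=> a aK; apply: le_trans (_ : (n %/ K)%:R + 1 <= _).
    by rewrite natr1 ler_nat count_class_leq.
  have : (n %/ K)%:R <= Num.sqrt n%:R :> R.
    apply: le_trans (_ : n%:R / K%:R <= _).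
      by rewrite ler_pdivlMr // -natrM ler_nat leq_divM.
    rewrite ler_pdivrMr // -{1}(sqr_sqrtr (ltW n0R)) expr2 ler_wpM2l ?sqrtr_ge0 //.
    rewrite -(@ler_pXn2r _ 2) ?nnegrE ?sqrtr_ge0 ?ler0n // sqr_sqrtr ?(ltW n0R) //.
    by rewrite -natrX ler_nat ltnW // expnS expn1.
  by lra.
have e4 : Num.sqrt (Num.sqrt n%:R) = n%:R `^ 4^-1 :> R.
  rewrite -powR12_sqrt ?sqrtr_ge0 // -powR12_sqrt ?(ltW n0R) // -powRrM.
  by congr (_ `^ _); field.
have q4 : 0 < n%:R `^ 4^-1 :> R by rewrite powR_gt0.
(* This is K <= B n^D raised to the power [d]. *)
have : (n%:R `^ 4^-1)^-1 <= B%:R `^ d * K%:R `^ (- d) :> R.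
  rewrite powRN ler_pdivlMr ?powR_gt0 // mulrC ler_pdivrMr //.
  rewrite -Dd powRrM powR_mulrn ?(ltW n0R) // -powRM ?exprn_ge0 ?(ltW n0R) // -natrX -natrM.
  by rewrite ge0_ler_powR ?nnegrE ?(ltW d0) // ler_nat.
have := sqrtn_leq_nprimes R n1; rewrite -/P e4 => h1 h2.
have h3 : 2 * Num.sqrt n%:R <= 32 / ln 2 * P * (B%:R `^ d * K%:R `^ (- d)).
  apply: le_trans (_ : 2 * (16 / ln 2 * P / n%:R `^ 4^-1) <= _).
    by rewrite ler_pM2l.
  have -> : 2 * (16 / ln 2 * P / n%:R `^ 4^-1) = 32 / ln 2 * P * (n%:R `^ 4^-1)^-1.
    by rewrite !mulrA; congr (_ * _ * _ * _); ring.
  by rewrite ler_wpM2l // !mulr_ge0 // invr_ge0 ltW.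
apply: le_trans h3 _.
have -> : 32 / ln 2 * P * (B%:R `^ d * K%:R `^ (- d)) =
   32 / ln 2 * B%:R `^ d * P * K%:R `^ (- d) by ring.
by rewrite !ler_wpM2r // lerDr divr_ge0 // ltW.
Qed.

(** Expanding the product of the 1 + g(q) gives a sum over sets of primes; the hypothesis bounds the
    average of each term, and the bounds reassemble into a product. *)
Lemma sum_prod_dvd_leq (R : realType) (ps : seq nat) (F : nat -> nat) (g h : nat -> R) (M : R) :
  (forall q, 0 <= g q) ->
  (forall ks, uniq ks -> all prime ks ->
    (count (fun p => all (fun q => q %| F p)%N ks) ps)%:R <= M * \prod_(q <- ks) h q) ->
  forall qs, uniq qs -> all prime qs ->
  \sum_(p <- ps) \prod_(q <- qs | (q %| F p)%N) (1 + g q) <=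
  M * \prod_(q <- qs) (1 + g q * h q).
Proof.
move=> g0 hM qs.
(* [ks] holds the primes whose term g(q) has been chosen in the expansion. *)
suff gen ks : uniq (ks ++ qs) -> all prime (ks ++ qs) ->
    \sum_(p <- ps | all (fun q => q %| F p)%N ks) \prod_(q <- qs | (q %| F p)%N) (1 + g q)
    <= M * \prod_(q <- ks) h q * \prod_(q <- qs) (1 + g q * h q).
  by move=> uqs pqs; have := gen [::] uqs pqs; rewrite big_nil mulr1.
elim: qs ks => [|q qs IHqs] ks.
  rewrite cats0 big_nil mulr1 => uks pks; apply: le_trans (hM ks uks pks).
  rewrite (eq_bigr (fun=> 1)) => [|p _]; last by rewrite big_nil.
  by rewrite big_const_seq iter_addr_0.
move=> uks pks.
have split p : \prod_(q' <- q :: qs | (q' %| F p)%N) (1 + g q') =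
    \prod_(q' <- qs | (q' %| F p)%N) (1 + g q') +
    g q * (if (q %| F p)%N then \prod_(q' <- qs | (q' %| F p)%N) (1 + g q') else 0).
  by rewrite big_cons; case: ifP => _; rewrite ?mulr0 ?addr0 // mulrDl mul1r.
rewrite (eq_bigr _ (fun p _ => split p)) big_split /= -mulr_sumr -big_mkcondr /=.
have e : perm_eq ((q :: ks) ++ qs) (ks ++ q :: qs) by rewrite perm_sym -[q :: qs]cat1s perm_catCA.
have h1 : \sum_(p <- ps | all (fun q => q %| F p)%N ks) \prod_(q <- qs | (q %| F p)%N) (1 + g q)
    <= M * \prod_(q <- ks) h q * \prod_(q <- qs) (1 + g q * h q).
  apply: IHqs.
    by move: uks; rewrite -(perm_uniq e) => /andP[].
  by move: pks; rewrite -(perm_all _ e) => /andP[].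
have h2 : \sum_(p <- ps | all (fun q => q %| F p)%N ks && (q %| F p)%N)
      \prod_(q <- qs | (q %| F p)%N) (1 + g q)
    <= M * \prod_(q <- q :: ks) h q * \prod_(q <- qs) (1 + g q * h q).
  rewrite (eq_bigl (fun p => all (fun q => q %| F p)%N (q :: ks))) => [|p].
    by apply: IHqs; rewrite ?(perm_uniq e) ?(perm_all _ e).
  by rewrite /= andbC.
apply: le_trans (lerD h1 (ler_wpM2l (g0 q) h2)) _.
by rewrite !big_cons le_eqVlt; apply/orP; left; apply/eqP; ring.
Qed.

(** * The ratio of an integer to its totient and its moments *)

Lemma totient_ratioE (R : realType) m : (0 < m)%N ->
  m%:R / (totient m)%:R = \prod_(q <- primes m) (q%:R / q.-1%:R) :> R.
Proof.
move=> m0; rewrite totientE // {1}[m]prod_prime_decomp // prime_decompE big_map /=.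
rewrite !natr_prod -prodf_div; apply: eq_big_seq => q.
rewrite -logn_gt0 => l0; have : q \in primes m by rewrite -logn_gt0.
rewrite mem_primes => /andP[/prime_gt1 q1 _].
have q0 : q%:R != 0 :> R by rewrite pnatr_eq0; lia.
have q1' : q.-1%:R != 0 :> R by rewrite pnatr_eq0; lia.
have -> : (q ^ logn q m = q * q ^ (logn q m).-1)%N by rewrite -expnS prednK.
have e0 : (q ^ (logn q m).-1)%:R != 0 :> R by rewrite pnatr_eq0 -lt0n expn_gt0 ltnW.
rewrite !natrM; move: (_ ^ _)%N%:R e0 => c c0.
by field; rewrite c0 q1'.
Qed.

(** Averaging over p needs one list of primes [q] that is independent of p. *)
Lemma primes_nprimes Y m : (0 < m <= Y)%N -> primes m = [seq q <- nprimes Y | (q %| m)%N].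
Proof.
move=> /andP[m0 mY]; rewrite -(@filter_pi_of m Y.+1) ?ltnS // /nprimes -filter_predI.
by apply: eq_filter => q; rewrite !inE /= mem_primes m0 /= andbC.
Qed.

Lemma expR_leq1D4 (R : realType) (u : R) : 0 <= u <= 1 -> expR u <= 1 + 4 * u.
Proof.
move=> /andP[u0 u1].
have h : expR (u / 2) * (1 - u / 2) <= 1.
  have := expR_ge1Dx (- (u / 2)).
  rewrite expRN => h; have e0 := expR_gt0 (u / 2).
  by rewrite mulrC -ler_pdivlMr // div1r.
have -> : expR u = expR (u / 2) ^+ 2 by rewrite expr2 -expRD; congr expR; field.
have e0 := expR_gt0 (u / 2).
move: (expR (u / 2)) e0 h => e e0 h.
have h2 : (e * (1 - u / 2)) ^+ 2 <= 1 by rewrite exprn_ile1 // mulr_ge0 //; lra.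
have v0 : 0 < (1 - u / 2) ^+ 2 by rewrite exprn_gt0 //; lra.
rewrite -(ler_pM2r v0) -exprMn (le_trans h2) //.
(* (1 + 4u)(1 - u/2)^2 - 1 equals this product plus u/4. *)
have h3 : 0 <= u * ((1 - u) * (11 / 4 - u)) by rewrite !mulr_ge0 //; lra.
lra.
Qed.

(** The power is at most exp(s/(q - 1)), whose exponent is below 1 thanks to q > s + 2; the 8 is 4
    times 2, from q <= 2 (q - 1). *)
Lemma expn_totient_factor_leq (R : realType) s q : (s.+2 < q)%N ->
  (q%:R / q.-1%:R) ^+ s <= 1 + 8 * s%:R / q%:R :> R.
Proof.
move=> sq.
have q0 : 0 < q.-1%:R :> R by rewrite ltr0n; lia.
have e : q%:R = 1 + q.-1%:R :> R by rewrite nat1r prednK //; lia.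
have e1 : q%:R / q.-1%:R = 1 + q.-1%:R^-1 :> R.
  by rewrite e mulrDl mul1r mulfV ?gt_eqF // addrC.
have qR : 0 < q%:R :> R by rewrite ltr0n; lia.
apply: le_trans (_ : expR (s%:R / q.-1%:R) <= _).
  rewrite e1 expRM_natl lerXn2r ?nnegrE ?expR_ge0 ?addr_ge0 ?invr_ge0 ?(ltW q0) //.
  exact: expR_ge1Dx.
apply: le_trans (expR_leq1D4 _) _.
  rewrite divr_ge0 //= ler_pdivrMr // mul1r ler_nat; lia.
rewrite lerD2l; have -> : 8 * s%:R / q%:R = 4 * (s%:R * (2 / q%:R)) :> R by field; rewrite gt_eqF.
rewrite ler_pM2l // ler_wpM2l // ler_pdivlMr // mulrC ler_pdivrMr //.
rewrite -natrM ler_nat; lia.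
Qed.

Lemma moment_totient_ratio_leq (R : realType) (f : {poly int}) : zcontents f = 1 ->
  (forall p, prime p -> (0 < poly_absz f p)%N) ->
  exists K M Z : R, [/\ 1 <= K, 0 < M, 0 <= Z & forall n s : nat, (1 < n)%N ->
    \sum_(p <- nprimes n) val_over_totient R f p ^+ s <=
    (K * ln (s%:R + 2)) ^+ s * (M * (size (nprimes n))%:R * expR (Z * s%:R))].
Proof.
move=> fp fpos; have [K K1 HK] := prod_inv_prime_leq R.
have [M M0 HM] := count_all_dvd_leq R fp fpos.
set D := size f in HM; set d : R := (4 * D%:R)^-1 in HM.
have D1 : (0 < D)%N.
  by rewrite lt0n size_poly_eq0; apply: contra_eq_neq fp => ->; rewrite zcontents0.
have D0 : 0 < D%:R :> R by rewrite ltr0n.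
have d0 : 0 < d by rewrite invr_gt0 mulr_gt0.
(* The last witness comes from the sum of 8 s D q^(-1-d) over q >= 2, which is at most 8 s D / d. *)
exists K, M, (8 * D%:R / d); split => // [|n s n1].
  by rewrite divr_ge0 ?mulr_ge0 // ltW.
(* [Y] exceeds every value in play, so the primes up to [Y] contain all their prime divisors. *)
pose Y := (s.+2 + \sum_(p <- nprimes n) poly_absz f p)%N.
pose qs := [seq q <- nprimes Y | (s.+2 < q)%N].
have pqs q : q \in qs -> prime q /\ (s.+2 < q)%N.
  by rewrite mem_filter mem_nprimes => /and3P[].
have ratio1 q : prime q -> 1 <= q%:R / q.-1%:R :> R.
  by move=> /prime_gt1 q1; rewrite ler_pdivlMr ?mul1r ?ler_nat ?leq_pred // ltr0n; lia.
pose g q : R := 8 * s%:R / q%:R.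
have g0 q : 0 <= g q by rewrite divr_ge0 // mulr_ge0.
have small : \prod_(q <- nprimes Y | (q <= s.+2)%N) (q%:R / q.-1%:R) <= K * ln (s%:R + 2).
  have -> : s%:R + 2 = s.+2%:R :> R by rewrite -natrD addn2.
  apply: le_trans (HK s.+2 isT); rewrite le_eqVlt; apply/orP; left; apply/eqP.
  rewrite /nprimes big_filter_cond /= [RHS](big_nat_widen _ _ Y.+1) //.
  by rewrite ltnS /Y leq_addr.
have pointwise p : p \in nprimes n -> val_over_totient R f p ^+ s <=
    (K * ln (s%:R + 2)) ^+ s * \prod_(q <- qs | (q %| poly_absz f p)%N) (1 + g q).
  move=> pn; have m0 : (0 < poly_absz f p)%N.
    by apply: fpos; move: pn; rewrite mem_nprimes => /andP[].
  have mY : (0 < poly_absz f p <= Y)%N.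
    by rewrite m0 /Y (big_rem p) //= addnCA leq_addr.
  rewrite /val_over_totient -/(poly_absz f p) totient_ratioE // (primes_nprimes mY).
  rewrite big_filter (bigID (fun q => q <= s.+2)%N) /= exprMn.
  have nneg (P : pred nat) : 0 <= \prod_(q <- nprimes Y | P q) (q%:R / q.-1%:R) :> R.
    by rewrite prodr_ge0 // => q _; rewrite divr_ge0.
  apply: ler_pM; rewrite ?exprn_ge0 //.
    rewrite lerXn2r ?nnegrE ?(le_trans (nneg _) small) //.
    (* All factors are at least 1, so the divisibility condition may be dropped. *)
    apply: le_trans small; rewrite [leLHS]big_mkcondl [leLHS]big_seq_cond [leRHS]big_seq_cond.
    apply: ler_prod => q; rewrite mem_nprimes => /andP[/andP[pq _] _].
    by case: ifP => _; rewrite ?divr_ge0 ?ler01 //= ratio1.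
  rewrite -prodrXl /qs big_filter_cond big_seq_cond [leRHS]big_seq_cond.
  rewrite (eq_bigl
    (fun q => (q \in nprimes Y) && ((s.+2 < q) && (q %| poly_absz f p)))%N); last first.
    by move=> q; rewrite -ltnNge [in LHS](andbC (q %| _)%N).
  apply: ler_prod => q /and3P[_ sq _].
  by rewrite exprn_ge0 ?divr_ge0 //= expn_totient_factor_leq.
have prodle : \prod_(q <- qs) (1 + g q * (D%:R * q%:R `^ (- d))) <= expR (8 * D%:R / d * s%:R).
  apply: le_trans (_ : expR (\sum_(q <- qs) g q * (D%:R * q%:R `^ (- d))) <= _).
    rewrite expR_sum; apply: ler_prod => q _.
    by rewrite expR_ge1Dx addr_ge0 // mulr_ge0 // mulr_ge0 // powR_ge0.
  rewrite ler_expR.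
  have -> : 8 * D%:R / d * s%:R = 8 * s%:R * D%:R * d^-1 by ring.
  (* The sum over primes is enlarged to all integers q >= 2. *)
  apply: le_trans (_ : 8 * s%:R * D%:R *
    \sum_(2 <= q < Y.+1) q%:R^-1 * q%:R `^ (- d) <= _); last first.
    by rewrite ler_wpM2l ?mulr_ge0 // sum_inv_powR_leq.
  rewrite mulr_sumr /qs big_filter /nprimes big_filter_cond /=.
  rewrite [leRHS](big_nat_widenl _ 0%N) // [leLHS]big_mkcond [leRHS]big_mkcond /=.
  have G0 q : 0 <= 8 * s%:R * D%:R * (q%:R^-1 * q%:R `^ (- d)) :> R.
    by rewrite !mulr_ge0 ?invr_ge0 ?powR_ge0.
  apply: ler_sum => q _; case: ifP => [/andP[/prime_gt1 -> _]|_]; last by case: ifP.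
  by rewrite /g le_eqVlt; apply/orP; left; apply/eqP; ring.
apply: le_trans (_ : \sum_(p <- nprimes n) (K * ln (s%:R + 2)) ^+ s *
    \prod_(q <- qs | (q %| poly_absz f p)%N) (1 + g q) <= _).
  by rewrite big_seq [leRHS]big_seq; apply: ler_sum => p; exact: pointwise.
have L0 : 0 <= (K * ln (s%:R + 2)) ^+ s.
  by rewrite exprn_ge0 // mulr_ge0 ?(le_trans ler01 K1) // ln_ge0 // ler_wpDl // ler1n.
rewrite -mulr_sumr ler_wpM2l //.
have hM ks := HM n ks n1.
apply: le_trans (sum_prod_dvd_leq g0 hM _ _) _.
- by rewrite filter_uniq ?nprimes_uniq.
- by apply/allP => q /pqs[].
- by rewrite ler_wpM2l // mulr_ge0 // ltW.
Qed.

(** * Moment and tail bounds over the primes up to a real number *)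

Theorem theorem1p5 (R : realType) (f : {poly int})
    (f_lead : 0 < lead_coef f)
    (f_prim : zcontents f = 1)
    (f_pos : forall p : nat, prime p -> 0 < f.[p%:Z]) :
  exists C c1 c2 : R,
    [/\ 0 < C, 0 < c1, 0 < c2 &
      forall x : R, 2 <= x ->
        (forall s : nat, (0 < s)%N ->
          \sum_(p <- primes_upto x) val_over_totient R f p ^+ s
            <= expR (s%:R * ln (ln (s%:R + 2)) + C * s%:R) * (prime_pi x)%:R)
        /\
        (forall t : R, 0 < t ->
          (count (fun p => t < val_over_totient R f p) (primes_upto x))%:R
            <= c1 * expR (- expR (c2 * t)) * (prime_pi x)%:R)].
Proof.
have fpos p : prime p -> (0 < poly_absz f p)%N.
  by move=> /f_pos h; rewrite /poly_absz absz_gt0 gt_eqF.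
have [K [M [Z [K1 M0 Z0 moment]]]] := moment_totient_ratio_leq R f_prim fpos.
(* The constant factor [M] is absorbed by M <= exp(M s), valid for s >= 1. *)
pose C := ln K + M + Z.
have C0 : 0 < C by rewrite ltr_wpDr // ltr_wpDl // ln_ge0.
have logs s : 0 < ln (s%:R + 2) :> R by rewrite ln_gt0 // ltr_wpDl // ltr1n.
have part1 n s : (1 < n)%N -> (0 < s)%N ->
    \sum_(p <- nprimes n) val_over_totient R f p ^+ s
      <= expR (s%:R * ln (ln (s%:R + 2)) + C * s%:R) * (size (nprimes n))%:R.
  move=> n1 s0; apply: le_trans (moment n s n1) _.
  set P : R := (size _)%:R.
  rewrite [M * P]mulrC -mulrA mulrCA mulrC ler_wpM2r // exprMn.
  have -> : expR (s%:R * ln (ln (s%:R + 2)) + C * s%:R) =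
      expR (ln K * s%:R) * ln (s%:R + 2) ^+ s * (expR (M * s%:R) * expR (Z * s%:R)).
    rewrite -[in RHS](@lnK _ (ln (s%:R + 2))) ?posrE // -expRM_natl -!expRD.
    by congr expR; rewrite /C; ring.
  have -> : expR (ln K * s%:R) = K ^+ s.
    by rewrite mulrC expRM_natl lnK // posrE (lt_le_trans ltr01 K1).
  rewrite ler_wpM2l //.
    by rewrite mulr_ge0 ?exprn_ge0 ?(ltW (logs s)) ?(le_trans ler01 K1).
  rewrite ler_wpM2r ?expR_ge0 //; apply: le_trans (expR_ge1Dx _).
  have : M <= M * s%:R by rewrite ler_peMr ?(ltW M0) // ler1n.
  lra.
(* With T = exp(c2 t) and s + 2 <= T <= s + 3, this c2 gives ln ln (s + 2) <= ln t - C - 1, so the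
   moment divided by t^s is at most e^(-s) pi(x), and e^(-s) <= e^(3 - T). *)
exists C, (expR 3), (expR (- (C + 1))); split => //; rewrite ?expR_gt0 //.
move=> x x2; set n := Num.truncn x.
have n1 : (1 < n)%N by rewrite truncn_ge_nat // (le_trans _ x2).
rewrite /prime_pi -[primes_upto x]/(nprimes n).
split=> [s s0|t t0]; first exact: part1.
set P : R := (size _)%:R; set T := expR (expR (- (C + 1)) * t).
have cP : (count (fun p => t < val_over_totient R f p) (nprimes n))%:R <= P.
  by rewrite ler_nat count_size.
rewrite -expRD; set s := (Num.truncn T - 2)%N.
have T0 : 0 <= T by exact: expR_ge0.
have Tlt : T < (Num.truncn T).+1%:R by exact: truncnS_gt.
(* The subtraction in [s] is truncated: s = 0 means T < 3, where the factor exp(3 - T) exceeds 1 and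
   the trivial count suffices. *)
have [s0|s0] := posnP s.
  apply: le_trans cP _; rewrite ler_peMl // -[leLHS]expR0 ler_expR subr_ge0.
  apply: le_trans (ltW Tlt) _; rewrite ler_nat; lia.
have Ts : T <= s%:R + 3.
  apply: le_trans (ltW Tlt) _; rewrite -natrD ler_nat; lia.
have sT : s%:R + 2 <= T.
  rewrite -natrD -truncn_ge_nat //; lia.
have lns : ln (ln (s%:R + 2)) <= ln t - (C + 1).
  have -> : ln t - (C + 1) = ln (expR (- (C + 1)) * t).
    by rewrite lnM ?posrE ?expR_gt0 // expRK addrC.
  rewrite ler_ln ?posrE ?mulr_gt0 ?expR_gt0 //.
  rewrite -[leRHS]expRK -/T ler_ln ?posrE ?expR_gt0 //.
  by rewrite ltr_wpDl.
have ts : 0 < t ^+ s by rewrite exprn_gt0.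
rewrite -(ler_pM2l ts).
have v0 p : 0 <= val_over_totient R f p by rewrite /val_over_totient divr_ge0.
(* Markov's inequality for the moment of order [s]. *)
apply: le_trans (_ : \sum_(p <- nprimes n) val_over_totient R f p ^+ s <= _).
  rewrite [leRHS](bigID (fun p => t < val_over_totient R f p)) /= ler_wpDr //.
    by rewrite sumr_ge0 // => p _; rewrite exprn_ge0.
  rewrite -sum1_count natr_sum mulr_sumr; apply: ler_sum => p tp.
  by rewrite mulr1 lerXn2r ?nnegrE ?(ltW tp) ?(ltW t0) // v0.
apply: le_trans (part1 n s n1 s0) _.
rewrite mulrA ler_wpM2r //.
have -> : t ^+ s = expR (s%:R * ln t) by rewrite expRM_natl lnK.
rewrite -expRD ler_expR.
have : s%:R * ln (ln (s%:R + 2)) <= s%:R * (ln t - (C + 1)) by rewrite ler_wpM2l.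
rewrite mulrBr mulrDr mulr1 [C * _]mulrC -/T.
move: Ts; clear; clearbody C T s.
move: s%:R (s%:R * ln (ln _)) (s%:R * ln t) (s%:R * C) => e a b c; lra.
Qed.
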